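(* Let $d$ be even and let $T:\mathcal{M}_d\to\mathcal{M}_d$ be a quantum channel (linear, completely positive, trace-preserving) which is $O(d)$-covariant, i.e. $T(O\rho O^T)=O\,T(\rho)\,O^T$ for all $\rho\in\mathcal{M}_d$ and all real orthogonal $O\in\mathcal{M}_d$. Then $T$ is a mixture of unitary channels: $T(\rho)=\sum_ip_iU_i\rho U_i^\dagger$ for some probabilities $p_i$ and unitaries $U_i$. *)

(* Defs.v *)
From mathcomp Require Import all_boot all_algebra.
From mathcomp Require Import complex reals.
Set Implicit Arguments. Unset Strict Implicit. Unset Printing Implicit Defensive.
Import GRing.Theory Num.Theory.
Local Open Scope ring_scope.

Definition adjmx (C : numClosedFieldType) (m n : nat) (A : 'M[C]_(m, n))
  : 'M[C]_(n, m) := \matrix_(i, j) Num.conj (A j i).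

Definition psd (C : numClosedFieldType) (d : nat) (A : 'M[C]_d) : Prop :=
  forall v : 'cV[C]_d, 0 <= (adjmx v *m A *m v) 0 0.

(* positive semidefiniteness of an element of M_n (x) M_d, represented as an
   n x n array of d x d blocks B i j: for every vector x = (v_1,...,v_n) in
   C^n (x) C^d, x^dagger B x = sum_{i,j} v_i^dagger B_ij v_j >= 0. *)
Definition block_psd (C : numClosedFieldType) (n d : nat)
    (B : 'I_n -> 'I_n -> 'M[C]_d) : Prop :=
  forall v : 'I_n -> 'cV[C]_d,
    0 <= \sum_(i < n) \sum_(j < n) (adjmx (v i) *m B i j *m v j) 0 0.

Definition completely_positive (C : numClosedFieldType) (d : nat)
    (T : 'M[C]_d -> 'M[C]_d) : Prop :=
  forall (n : nat) (B : 'I_n -> 'I_n -> 'M[C]_d),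
    block_psd B -> block_psd (fun i j => T (B i j)).

Definition trace_preserving (C : numClosedFieldType) (d : nat)
    (T : 'M[C]_d -> 'M[C]_d) : Prop :=
  forall rho : 'M[C]_d, \tr (T rho) = \tr rho.

Definition quantum_channel (C : numClosedFieldType) (d : nat)
    (T : 'M[C]_d -> 'M[C]_d) : Prop :=
  linear T /\ completely_positive T /\ trace_preserving T.

Definition cplx_mx (R : rcfType) (m n : nat) (O : 'M[R]_(m, n)) : 'M[R[i]]_(m, n) :=
  map_mx (fun r => (r%:C)%C) O.

Definition orthogonal_mx (R : rcfType) (d : nat) (O : 'M[R]_d) : Prop :=
  O *m O^T = 1%:M.

Definition unitary_mx (C : numClosedFieldType) (d : nat) (U : 'M[C]_d) : Prop :=
  U *m adjmx U = 1%:M.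

Definition O_covariant (R : rcfType) (d : nat) (T : 'M[R[i]]_d -> 'M[R[i]]_d) : Prop :=
  forall (O : 'M[R]_d) (rho : 'M[R[i]]_d), orthogonal_mx O ->
    T (cplx_mx O *m rho *m (cplx_mx O)^T) = cplx_mx O *m T rho *m (cplx_mx O)^T.

Definition mixture_of_unitaries (R : rcfType) (d : nat)
    (T : 'M[R[i]]_d -> 'M[R[i]]_d) : Prop :=
  exists (k : nat) (p : 'I_k -> R) (U : 'I_k -> 'M[R[i]]_d),
    [/\ forall l, 0 <= p l, \sum_(l < k) p l = 1,
        forall l, unitary_mx (U l) &
        forall rho : 'M[R[i]]_d,
          T rho = \sum_(l < k) ((p l)%:C)%C *: (U l *m rho *m adjmx (U l))].

(* Main.v *)
Require Import Defs.
From HB Require Import structures.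
From mathcomp Require Import all_boot all_fingroup all_algebra.
From mathcomp Require Import complex reals.
From mathcomp Require Import ring.

Set Implicit Arguments. Unset Strict Implicit. Unset Printing Implicit Defensive.
Import GRing.Theory Num.Theory.
Local Open Scope ring_scope.

(** Covariance under signed permutation matrices forces
    [T X = a X + b X^T + c (tr X) 1 + e diag X], and one further reflection kills [e].
    Complete positivity, tested on the maximally entangled vector and on
    [E_ij -+ E_ji], and trace preservation leave the simplex spanned by the identity,
    by [tr X 1 - X^T] (antisymmetric Kraus operators) and by
    [tr X 1 + X^T - (2/d) X] (traceless symmetric Kraus operators).  For even [d] there
    is a fixed-point-free involution of the indices; averaging (anti)symmetric unitaries
    supported on it over signs and permutations yields [tr X 1 - X^T] and
    [tr X 1 + X^T - 2 diag X], while averaging balanced diagonal sign matrices yields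
    [d diag X - X], which supplies the remaining diagonal part. *)

(** * Monomial matrices *)

(** The coefficient ring is left general: with signs [f] the same matrix serves as an orthogonal
    matrix over the reals and as a unitary over the complex numbers. *)
Definition monomial_mx (A : pzRingType) (d : nat) (f : 'I_d -> A) (s : 'S_d) : 'M[A]_d :=
  \matrix_(k, l) (f k *+ (l == s k)).

Lemma monomial_mx_conj (A : comPzRingType) (d : nat) (f g : 'I_d -> A) (s : 'S_d)
    (X : 'M[A]_d) :
  monomial_mx f s *m X *m (monomial_mx g s)^T =
  \matrix_(k, l) (f k * g l * X (s k) (s l)).
Proof.
apply/matrixP => k l; rewrite !mxE (bigD1 (s l)) //= big1 ?addr0; last first.
  by move=> m /negPf ml; rewrite !mxE ml mulr0n mulr0.
rewrite !mxE eqxx mulr1n (bigD1 (s k)) //= big1 ?addr0; last first.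
  by move=> m /negPf mk; rewrite !mxE mk mulr0n mul0r.
by rewrite !mxE eqxx mulr1n mulrAC.
Qed.

Lemma monomial_mx_unit (A : comPzRingType) (d : nat) (f g : 'I_d -> A) (s : 'S_d) :
  (forall k, f k * g k = 1) -> monomial_mx f s *m (monomial_mx g s)^T = 1%:M.
Proof.
move=> fg1; have := monomial_mx_conj f g s 1%:M; rewrite mulmx1 => ->.
apply/matrixP => k l; rewrite !mxE (inj_eq perm_inj).
by case: eqVneq => [->|_]; rewrite ?fg1 ?mulr1 ?mulr0.
Qed.

Definition diag_part (A : pzRingType) (d : nat) (X : 'M[A]_d) : 'M[A]_d :=
  diag_mx (\row_i X i i).

(** * Averages over permutations and over signs *)

Lemma exists_perm_pair (d : nat) (i j k l : 'I_d) :
  i != j -> k != l -> exists s : 'S_d, s i = k /\ s j = l.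
Proof.
(* The second transposition sends the image of [j] to [l]; it fixes [k], since neither [l] nor that
   image equals [k]. *)
move=> ij kl; exists (tperm i k * tperm (tperm i k j) l)%g; rewrite !permM tpermL.
split; last by rewrite tpermL.
by rewrite [LHS]tpermD // 1?eq_sym // -(inj_eq (@perm_inj _ (tperm i k))) tpermK tpermR.
Qed.

(** Double counting. By 2-transitivity the sum over [t] is the same for every ordered pair of
    distinct indices; added up over all [d * d.-1] pairs, each [t] contributes the whole
    off-diagonal sum. *)
Lemma sum_perm_pair (d : nat) (V : nmodType) (X : 'I_d -> 'I_d -> V) (i j : 'I_d) :
  i != j ->
  (\sum_(t : 'S_d) X (t i) (t j)) *+ (d * d.-1) =
  (\sum_a \sum_(b | b != a) X a b) *+ d`!.
Proof.
move=> ij.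
have trans (i' j' : 'I_d) : j' != i' ->
    \sum_(t : 'S_d) X (t i') (t j') = \sum_(t : 'S_d) X (t i) (t j).
  rewrite eq_sym => /(exists_perm_pair ij)[s [si sj]].
  rewrite [RHS](reindex_inj (mulgI s)); apply: eq_bigr => t _.
  by rewrite !permM si sj.
transitivity (\sum_i' \sum_(j' | j' != i') \sum_(t : 'S_d) X (t i') (t j')).
  have E i' : \sum_(j' | j' != i') \sum_(t : 'S_d) X (t i') (t j') =
      (\sum_(t : 'S_d) X (t i) (t j)) *+ d.-1.
    by rewrite (eq_bigr _ (trans i')) sumr_const cardC1 card_ord.
  by rewrite (eq_bigr _ (fun i' _ => E i')) sumr_const card_ord mulnC mulrnA.
under eq_bigr => i' _ do rewrite exchange_big /=.
rewrite exchange_big /= -[d`!]card_Sn -sumr_const; apply: eq_bigr => t _.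
rewrite [RHS](reindex_inj (@perm_inj _ t)); apply: eq_bigr => i' _.
rewrite [RHS](reindex_inj (@perm_inj _ t)); apply: eq_bigl => j'.
by rewrite (inj_eq perm_inj).
Qed.

(** The sign [e k (+) e (s k)] is constant on the orbits of the involution [s]. If [l] lies in the
    orbit of [k], the two factors agree; otherwise flipping [e] at [k] alone negates the summand. *)
Lemma sum_signs (C : numDomainType) (d : nat) (s : 'S_d) (k l : 'I_d) :
  (forall i, s (s i) = i) -> (forall i, s i != i) ->
  \sum_(e : {ffun 'I_d -> bool})
     (-1) ^+ (e k (+) e (s k)) * (-1) ^+ (e l (+) e (s l)) =
  ((l == k) || (l == s k))%:R * (2 ^ d)%:R :> C.
Proof.
move=> sK sN; case: (boolP ((l == k) || (l == s k))) => lk.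
  rewrite mul1r (eq_bigr (fun=> 1)) => [|e _].
    by rewrite sumr_const card_ffun card_bool card_ord.
  case/orP: lk => /eqP ->; rewrite ?sK -signr_addb.
    by rewrite addbb.
  by rewrite [e (s k) (+) _]addbC addbb.
rewrite mul0r; case/norP: lk => lk lsk.
pose flip (e : {ffun 'I_d -> bool}) := [ffun i => (i == k) (+) e i].
have flipK : involutive flip.
  by move=> e; apply/ffunP => i; rewrite !ffunE addbA addbb.
set S := \sum_e _; suff: S = - S.
  by move/eqP; rewrite -addr_eq0 -mulr2n mulrn_eq0 => /eqP.
rewrite {1}/S (reindex_inj (inv_inj flipK)) -sumrN; apply: eq_bigr => e _.
rewrite !ffunE eqxx (negPf lk) (negPf (sN k)).
have /negPf -> : s l != k by apply: contraNneq lsk => <-; rewrite sK.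
by rewrite /= addNb signrN mulNr.
Qed.

(** * Calculus of weighted mixtures *)

(* The weights sum to [w] instead of [1], so that mixtures can be added and rescaled. *)
Definition weighted_mixture (C : numClosedFieldType) (d : nat) (w : C)
    (T : 'M[C]_d -> 'M[C]_d) : Prop :=
  exists s : seq (C * 'M[C]_d),
    [/\ forall x, x \in s -> 0 <= x.1 /\ unitary_mx x.2,
        \sum_(x <- s) x.1 = w
      & forall rho, T rho = \sum_(x <- s) x.1 *: (x.2 *m rho *m adjmx x.2)].

Section WeightedMixture.
Variables (C : numClosedFieldType) (d : nat).
Implicit Types (T : 'M[C]_d -> 'M[C]_d) (w a : C).

Lemma eq_weighted_mixture w w' T T' :
  w = w' -> T =1 T' -> weighted_mixture w T -> weighted_mixture w' T'.
Proof. by move=> <- eT [s [s1 s2 s3]]; exists s; split=> // rho; rewrite -eT. Qed.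

Lemma weighted_mixture0 : weighted_mixture (0 : C) (fun=> 0 : 'M[C]_d).
Proof. by exists [::]; split=> // [|rho]; rewrite big_nil. Qed.

Lemma weighted_mixtureD w1 w2 T1 T2 :
  weighted_mixture w1 T1 -> weighted_mixture w2 T2 ->
  weighted_mixture (w1 + w2) (fun rho => T1 rho + T2 rho).
Proof.
move=> [s1 [p1 q1 r1]] [s2 [p2 q2 r2]]; exists (s1 ++ s2); split.
- by move=> x; rewrite mem_cat => /orP[/p1|/p2].
- by rewrite big_cat q1 q2.
- by move=> rho; rewrite big_cat r1 r2.
Qed.

Lemma weighted_mixtureZ a w T :
  0 <= a -> weighted_mixture w T ->
  weighted_mixture (a * w) (fun rho => a *: T rho).
Proof.
move=> a0 [s [p q r]]; exists [seq (a * x.1, x.2) | x <- s]; split.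
- by move=> _ /mapP[x /p [x0 xU] ->]; split=> //=; apply: mulr_ge0.
- by rewrite big_map -q mulr_sumr.
- move=> rho; rewrite big_map r scaler_sumr; apply: eq_bigr => x _.
  by rewrite scalerA.
Qed.

Lemma weighted_mixture_sum (I : finType) (w : I -> C) (T : I -> 'M[C]_d -> 'M[C]_d) :
  (forall i, weighted_mixture (w i) (T i)) ->
  weighted_mixture (\sum_i w i) (fun rho => \sum_i T i rho).
Proof.
move=> H; elim: (index_enum I) => [|i r IH].
  apply: eq_weighted_mixture weighted_mixture0 => [|rho]; by rewrite big_nil.
apply: eq_weighted_mixture (weighted_mixtureD (H i) IH) => [|rho];
  by rewrite big_cons.
Qed.

Lemma weighted_mixture_unitary (U : 'M[C]_d) :
  unitary_mx U -> weighted_mixture 1 (fun rho => U *m rho *m adjmx U).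
Proof.
move=> HU; exists [:: (1, U)]; split=> [x||rho]; rewrite ?big_seq1 ?scale1r //.
by rewrite inE => /eqP->.
Qed.

Lemma weighted_mixture_sign (e : 'I_d -> bool) (s : 'S_d) :
  weighted_mixture (1 : C)
    (fun rho => \matrix_(k, l) ((-1) ^+ e k * (-1) ^+ e l * rho (s k) (s l))).
Proof.
pose f k : C := (-1) ^+ e k.
have adjE : adjmx (monomial_mx f s) = (monomial_mx f s)^T.
  apply/matrixP => k l; rewrite !mxE rmorphMn /= /f rmorphXn /= rmorphN1 //.
have U : unitary_mx (monomial_mx f s).
  rewrite /unitary_mx adjE monomial_mx_unit // => k.
  by rewrite /f -signr_addb addbb.
apply: eq_weighted_mixture (weighted_mixture_unitary U) => // rho.
by rewrite adjE monomial_mx_conj.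
Qed.

End WeightedMixture.

(** As [t] varies, the conjugate of a fixed-point-free [r] sends [k] to each [b != k] equally often:
    with [i] the preimage of [k] under [t], it sends [t i] to [t (r i)], and [i != r i]. *)
Lemma sum_perm_conj (C : numDomainType) (d : nat) (g : 'I_d -> C) (r : 'S_d) (k : 'I_d) :
  (forall i, r i != i) ->
  (\sum_(t : 'S_d) g ((r ^ t)%g k)) * d.-1%:R = d`!%:R * \sum_(b | b != k) g b.
Proof.
move=> rN; have d_gt0 : (0 < d)%N by apply: leq_ltn_trans (ltn_ord k).
have rN' i : i != r i by rewrite eq_sym.
have dn0 : d%:R != 0 :> C by rewrite pnatr_eq0 -lt0n.
apply: (mulIf dn0); rewrite -mulrA -natrM mulnC mulr_natr.
(* The indicator [a == k] selects [i = t^-1 k], so that the sum over [i] brings in the pairs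
   [(i, r i)] of [sum_perm_pair]. *)
pose X (a b : 'I_d) := g b *+ (a == k).
have -> : \sum_(t : 'S_d) g ((r ^ t)%g k) = \sum_i \sum_(t : 'S_d) X (t i) (t (r i)).
  rewrite exchange_big; apply: eq_bigr => t _.
  rewrite (bigD1 (t^-1%g k)) //= big1 => [|i ik].
    by rewrite /X permKV eqxx mulr1n addr0 conjgE !permM.
  by rewrite /X -(inj_eq (@perm_inj _ t^-1%g)) permK (negPf ik) mulr0n.
rewrite -sumrMnl (eq_bigr _ (fun i _ => sum_perm_pair X (rN' i))).
rewrite sumr_const card_ord [RHS]mulr_natr -[X in X *+ _]mulr_natl.
congr (_ * _ *+ _); rewrite (bigD1 k) //= [X in _ + X]big1 ?addr0 => [|a /negPf ak].
  by apply: eq_bigr => b _; rewrite /X eqxx mulr1n.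
by rewrite big1 // => b _; rewrite /X ak mulr0n.
Qed.

(** * Unitary mixtures built from a perfect matching of the indices *)

Section Mixtures.
Variables (C : numClosedFieldType) (d : nat).
Hypotheses (d_gt0 : (0 < d)%N) (d_even : ~~ odd d).

(* Fixed-point free, and parity reversing, because [d] is even. *)
Let revp : 'S_d := perm (@rev_ord_inj d).

Let odd_revp i : odd (revp i) = ~~ odd i.
Proof. by rewrite permE /= oddB ?ltn_ord // (negPf d_even). Qed.

Let revpN i : revp i != i.
Proof. by apply/eqP => /(congr1 (fun j : 'I_d => odd j)); rewrite odd_revp; case: odd. Qed.

Let scale_pos (n : nat) : 0 <= d.-1%:R / (d`! * n)%:R :> C.
Proof. by rewrite mulr_ge0 ?invr_ge0 ?ler0n. Qed.

(** The unitaries are signed permutation matrices of the conjugates of [revp], antisymmetric if [b]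
    and symmetric otherwise. Independent signs on the matched pairs remove every entry except those
    with [l = k] or [l] the partner of [k]. *)
Lemma weighted_mixture_matching (b : bool) :
  weighted_mixture (d.-1%:R : C)
    (fun rho : 'M[C]_d => (\tr rho)%:M + (-1) ^+ b *: rho^T
       - (1 + (-1) ^+ b) *: diag_part rho).
Proof.
pose p (t : 'S_d) := (revp ^ t)%g.
have pE t k : p t k = t (revp ((t^-1)%g k)) by rewrite /p conjgE !permM.
have pK t k : p t (p t k) = k.
  by rewrite !pE permK ![revp _]permE rev_ordK permKV.
have pN t k : p t k != k.
  by rewrite pE -(inj_eq (@perm_inj _ t^-1%g)) permK.
(* Matched indices have preimages under [t] of opposite parity, so for [b = true] this gives the two
   entries of a pair opposite signs. *)
pose s (t : 'S_d) k := b && odd ((t^-1)%g k).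
pose sg (t : 'S_d) (e : {ffun 'I_d -> bool}) k := s t k (+) (e k (+) e (p t k)).
have H := weighted_mixture_sum (fun t : 'S_d => weighted_mixture_sum
  (fun e : {ffun 'I_d -> bool} => weighted_mixture_sign C (sg t e) (p t))).
have n0 : (d`! * 2 ^ d)%:R != 0 :> C by rewrite pnatr_eq0 -lt0n muln_gt0 fact_gt0 expn_gt0.
apply: eq_weighted_mixture (weighted_mixtureZ (scale_pos (2 ^ d)) H).
  rewrite !sumr_const card_ffun card_bool card_ord card_Sn -mulrnA [(2 ^ d * _)%N]mulnC.
  by rewrite divfK.
move=> rho; apply/matrixP => k l; rewrite mxE summxE.
(* [F t] is the average over [e], computed by [sum_signs]. *)
pose F (t : 'S_d) := (-1) ^+ (s t k (+) s t l) * rho (p t k) (p t l) *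
   ((l == k) || (l == p t k))%:R : C.
have -> : \sum_(t : 'S_d) (\sum_(e : {ffun 'I_d -> bool})
    \matrix_(k', l') ((-1) ^+ sg t e k' * (-1) ^+ sg t e l' * rho (p t k') (p t l'))) k l
    = (\sum_(t : 'S_d) F t) * (2 ^ d)%:R.
  rewrite mulr_suml; apply: eq_bigr => t _.
  rewrite /F -[RHS]mulrA -(sum_signs _ _ _ (pK t) (pN t)) mulr_sumr summxE.
  apply: eq_bigr => e _; rewrite mxE /sg !signr_addb; ring.
suff key : (\sum_(t : 'S_d) F t) * d.-1%:R =
    d`!%:R * ((\tr rho)%:M + (-1) ^+ b *: rho^T - (1 + (-1) ^+ b) *: diag_part rho) k l.
  rewrite mulrAC mulrA [_ * (\sum_(t : 'S_d) _)]mulrC key.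
  by rewrite [d`!%:R * _]mulrC -[_ * _ * (2 ^ d)%:R]mulrA -natrM mulfK.
(* On the diagonal, the partner of [k] is equidistributed over the other indices, giving the trace
   minus [rho k k]. Off the diagonal only those [t] that match [k] with [l] count, each contributing
   the transposed entry. *)
rewrite {}/F; have [->|lk] := eqVneq l k.
  rewrite (eq_bigr (fun t => rho (p t k) (p t k))) => [|t _]; last first.
    by rewrite addbb mul1r mulr1.
  rewrite [LHS](sum_perm_conj (fun m => rho m m) k revpN) !mxE eqxx mulr1n.
  by rewrite /mxtrace [in RHS](bigD1 k) //=; ring.
rewrite (eq_bigr (fun t => (-1) ^+ b * rho l k *+ (l == p t k))) => [|t _]; last first.
  rewrite /=; case: eqVneq => [->|_]; last by rewrite mulr0.
  by rewrite mulr1 pK /s pE permK odd_revp -andb_addr addbN addbb andbT.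
rewrite [LHS](sum_perm_conj (fun m => (-1) ^+ b * rho l k *+ (l == m)) k revpN).
rewrite !mxE eq_sym (negPf lk) mulr0n add0r mulr0n mulr0 subr0.
rewrite (bigD1 l) //= eqxx mulr1n big1 ?addr0 // => m /andP[_ /negPf ml].
by rewrite eq_sym ml.
Qed.

(** A balanced sign vector has zero sum, so after averaging over permutations the product of two
    distinct entries has mean [- 1 / (d - 1)]. Conjugation thus keeps the diagonal and multiplies
    the rest by this mean. *)
Lemma weighted_mixture_diag :
  weighted_mixture (d.-1%:R : C)
    (fun rho : 'M[C]_d => d%:R *: diag_part rho - rho).
Proof.
have H := weighted_mixture_sum (fun t : 'S_d =>
  weighted_mixture_sign C (fun k => odd (t k)) 1%g).
have n0 : d`!%:R != 0 :> C by rewrite pnatr_eq0 -lt0n fact_gt0.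
have dn0 : d%:R != 0 :> C by rewrite pnatr_eq0 -lt0n.
apply: eq_weighted_mixture (weighted_mixtureZ (scale_pos 1) H).
  by rewrite !sumr_const card_Sn muln1 divfK.
move=> rho; apply/matrixP => k l; rewrite mxE summxE.
pose sgn (i : 'I_d) : C := (-1) ^+ odd i.
have -> : \sum_(t : 'S_d)
    (\matrix_(k', l') ((-1) ^+ odd (t k') * (-1) ^+ odd (t l')
      * rho ((1%g : 'S_d) k') ((1%g : 'S_d) l'))) k l
    = (\sum_(t : 'S_d) sgn (t k) * sgn (t l)) * rho k l.
  by rewrite mulr_suml; apply: eq_bigr => t _; rewrite mxE !perm1.
rewrite !mxE muln1; case: eqVneq => [->|kl].
  under eq_bigr => t _ do rewrite /sgn -signr_addb addbb.
  rewrite sumr_const card_Sn mulr1n mulrA divfK //.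
  by rewrite -subn1 natrB // mulrBl mul1r.
have sum_sgn : \sum_i sgn i = 0.
  have : \sum_i sgn i = - \sum_i sgn i.
    rewrite {1}(reindex_inj (@perm_inj _ revp)) -sumrN; apply: eq_bigr => i _.
    by rewrite /sgn odd_revp signrN.
  by move/eqP; rewrite -addr_eq0 -mulr2n mulrn_eq0 => /eqP.
(* The signs other than [sgn a] add up to [- sgn a], so each [a] contributes [-1]. *)
have pairs : \sum_a \sum_(b | b != a) sgn a * sgn b = - d%:R.
  rewrite -[d in RHS]card_ord -mulNrn -sumr_const; apply: eq_bigr => a _.
  rewrite -mulr_sumr; move: sum_sgn; rewrite (bigD1 a) //= => /eqP.
  by rewrite addrC addr_eq0 => /eqP ->; rewrite mulrN /sgn -signr_addb addbb.
have := sum_perm_pair (fun a b => sgn a * sgn b) kl.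
rewrite /= pairs mulnC mulrnA -[LHS]mulr_natr mulNrn -[d%:R *+ _]mulr_natl -mulNr.
move/(mulIf dn0); rewrite -[LHS]mulr_natr => key.
by rewrite mulr0n mulr0 sub0r mulrAC mulrA [_ * (\sum_t _)]mulrC key mulrAC mulNr divff // mulN1r.
Qed.

End Mixtures.

(** * Normal form of covariant linear maps *)

Lemma linear_delta_ext (A : nzRingType) (d : nat) (F G : 'M[A]_d -> 'M[A]_d) :
  linear F -> linear G -> (forall i j, F (delta_mx i j) = G (delta_mx i j)) -> F =1 G.
Proof.
move=> linF linG FG X.
pose F' : {linear 'M[A]_d -> 'M[A]_d} := HB.pack F (GRing.isLinear.Build _ _ _ _ F linF).
pose G' : {linear 'M[A]_d -> 'M[A]_d} := HB.pack G (GRing.isLinear.Build _ _ _ _ G linG).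
suff: F' X = G' X by [].
rewrite (matrix_sum_delta X) !linear_sum; apply: eq_bigr => i _.
by rewrite !linear_sum; apply: eq_bigr => j _; rewrite !linearZ /= FG.
Qed.

Lemma mxtrace_delta (A : pzRingType) (d : nat) (i j : 'I_d) :
  \tr (delta_mx i j : 'M[A]_d) = (i == j)%:R.
Proof.
rewrite /mxtrace (bigD1 i) //= big1 => [|k /negPf ki]; rewrite !mxE ?eqxx ?addr0 //.
by rewrite ki.
Qed.

Lemma linear_isotropic (A : comNzRingType) (d : nat) (a b c e : A) :
  linear (fun X : 'M[A]_d =>
    a *: X + b *: X^T + c *: (\tr X)%:M + e *: diag_part X).
Proof.
move=> x X Y; apply/matrixP => k l; rewrite !mxE mxtraceD mxtraceZ.
by case: eqVneq => _; rewrite ?mulr1n ?mulr0n; ring.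
Qed.

(** The tensor [t p q k l] of [T] is invariant under signed permutations. Sign flips leave only
    entries whose indices match in pairs, in one of three ways; 2-transitivity makes each type
    constant, which yields [a], [b], [c]. *)
Lemma signed_perm_covariant_form (C : numDomainType) (d : nat)
    (T : 'M[C]_d -> 'M[C]_d) (i j : 'I_d) :
  i != j -> linear T ->
  (forall (e : 'I_d -> bool) (s : 'S_d) (X : 'M[C]_d),
    T (\matrix_(k, l) ((-1) ^+ e k * (-1) ^+ e l * X (s k) (s l))) =
    \matrix_(k, l) ((-1) ^+ e k * (-1) ^+ e l * T X (s k) (s l))) ->
  exists a b c e : C, forall X : 'M[C]_d,
    T X = a *: X + b *: X^T + c *: (\tr X)%:M + e *: diag_part X.
Proof.
move=> ij linT cov; pose t p q k l := T (delta_mx p q) k l.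
have TZ x X : T (x *: X) = x *: T X.
  have T0 : T 0 = 0 by have := linT (-1) 0 0; rewrite scaler0 addr0 scaleN1r addNr.
  by have := linT x X 0; rewrite !addr0 T0 addr0.
(* Flipping the sign of basis vector [m]: each index must occur an even number of times. *)
have t0 m p q k l : (m == p) (+) (m == q) (+) ((m == k) (+) (m == l)) -> t p q k l = 0.
  have := cov (pred1 m) 1%g (delta_mx p q).
  have -> : \matrix_(k, l) ((-1) ^+ pred1 m k * (-1) ^+ pred1 m l *
      (delta_mx p q : 'M[C]_d) ((1%g : 'S_d) k) ((1%g : 'S_d) l))
      = (-1) ^+ ((m == p) (+) (m == q)) *: delta_mx p q.
    apply/matrixP => x y; rewrite !mxE !perm1 /= signr_addb.
    case: (eqVneq x p) => [->|_]; last by rewrite /= !mulr0.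
    case: (eqVneq y q) => [->|_]; last by rewrite /= !mulr0.
    by rewrite ![m == _]eq_sym.
  rewrite TZ => /matrixP/(_ k l); rewrite !mxE !perm1 /= -/(t p q k l) -signr_addb.
  rewrite ![_ == m]eq_sym; case: (_ (+) _); case: (_ (+) _) => //= /eqP + _.
    by rewrite expr1 mul1r mulN1r eq_sym -addr_eq0 -mulr2n mulrn_eq0 => /eqP.
  by rewrite expr1 mul1r mulN1r -addr_eq0 -mulr2n mulrn_eq0 => /eqP.
have tS (s : 'S_d) p q k l : t (s p) (s q) (s k) (s l) = t p q k l.
  have := cov (fun=> false) s (delta_mx (s p) (s q)).
  have -> : \matrix_(k, l) ((-1) ^+ false * (-1) ^+ false *
      (delta_mx (s p) (s q) : 'M[C]_d) (s k) (s l)) = delta_mx p q.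
    by apply/matrixP => x y; rewrite !mxE !mul1r !(inj_eq perm_inj).
  by move=> /matrixP/(_ k l); rewrite !mxE !mul1r.
have ta k l : k != l -> t k l k l = t i j i j.
  by move=> /(exists_perm_pair ij)[s [<- <-]].
have tb k l : k != l -> t k l l k = t i j j i.
  by move=> /(exists_perm_pair ij)[s [<- <-]].
have tc k l : k != l -> t k k l l = t i i j j.
  by move=> /(exists_perm_pair ij)[s [<- <-]].
have tf k : t k k k k = t i i i i by rewrite -(tS (tperm i k)) tpermR.
(* When all four indices coincide, the first three terms all contribute; [e] is the remaining
   excess. *)
exists (t i j i j), (t i j j i), (t i i j j),
  (t i i i i - t i j i j - t i j j i - t i i j j).
apply: linear_delta_ext => //; first exact: linear_isotropic.
move=> p q; apply/matrixP => k l; rewrite !mxE mxtrace_delta -/(t p q k l).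
(* If exactly one of [p = q] and [k = l] holds, some index occurs an odd number of times. If neither
   holds, only [(k, l) = (p, q)] and [(k, l) = (q, p)] survive. *)
have [->|pq] := eqVneq p q; have [->|kl] := eqVneq k l.
- rewrite andbb; have [->|ql] := eqVneq l q.
    rewrite tf /= ?mulr1n; ring.
  rewrite tc 1?eq_sym // /= ?mulr1n; ring.
- rewrite (t0 k) ?addbb ?eqxx ?(negPf kl) //.
  rewrite mulr0n !mulr0 !addr0.
  have /negPf kql : ~~ ((k == q) && (l == q)).
    by apply: contraNN kl => /andP[/eqP-> /eqP->].
  by rewrite kql andbC kql !mulr0 addr0.
- rewrite (t0 p) ?addbb ?eqxx ?(negPf pq) // mulr0n.
  by case: (eqVneq l p) => [->|_]; rewrite ?(negPf pq) /= !mulr0 !addr0.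
- rewrite !mulr0n !mulr0 !addr0.
  have [kp|kp] := eqVneq k p.
    have [lq|lq] := eqVneq l q.
      rewrite kp lq ta // eq_sym (negPf pq) /=; ring.
    rewrite (t0 q) ?kp ?eqxx ?[q == _]eq_sym ?(negPf pq) ?(negPf lq) //=.
    by rewrite eq_sym -kp (negPf kl) /= !mulr0 addr0.
  have [lp|lp] := eqVneq l p.
    have [kq|kq] := eqVneq k q.
      rewrite kq lp tb //=; ring.
    by rewrite (t0 q) ?lp ?eqxx ?[q == _]eq_sym ?(negPf pq) ?(negPf kq) //= !mulr0 addr0.
  by rewrite (t0 p) ?eqxx ?[p == l]eq_sym ?[p == k]eq_sym
    ?(negPf pq) ?(negPf lp) ?(negPf kp) //= !mulr0 addr0.
Qed.

(** Supplies a matrix outside the signed permutations. The unequal weights 1 and -2 matter: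
    reflecting along the difference of two basis vectors is a transposition, with zero entry at
    [(i, i)]. *)
Lemma exists_orthogonal_mixing (R : rcfType) (d : nat) (i j : 'I_d) :
  i != j -> exists O : 'M[R]_d, [/\ orthogonal_mx O, O i i != 0 & O j i != 0].
Proof.
move=> ij.
(* Householder reflection; [u^T u = 5] keeps all entries rational. *)
pose u : 'cV[R]_d := delta_mx i 0 - 2%:R *: delta_mx j 0.
have ui : u i 0 = 1 by rewrite !mxE !eqxx (negPf ij) /= mulr0 subr0.
have uj : u j 0 = - 2%:R by rewrite !mxE !eqxx eq_sym (negPf ij) /= mulr1 sub0r.
have u0 k : k != i -> k != j -> u k 0 = 0.
  by move=> /negPf ki /negPf kj; rewrite !mxE ki kj /= mulr0 subr0.
have uu : u^T *m u = 5%:R%:M.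
  apply/matrixP => x y; rewrite !ord1 [RHS]mxE eqxx mulr1n mxE.
  rewrite (bigD1 i) //= (bigD1 j) 1?eq_sym //= big1 => [|k /andP[ki kj]].
    rewrite ![u^T _ _]mxE ui uj; ring.
  by rewrite u0 // mulr0.
(* The Householder factor [2 / (u^T u)]. *)
pose al : R := 2%:R / 5%:R.
pose P := u *m u^T.
have PT : P^T = P by rewrite trmx_mul trmxK.
have PP : P *m P = 5%:R *: P.
  by rewrite /P -mulmxA [u^T *m _]mulmxA uu mul_scalar_mx -scalemxAr.
have OT : (1%:M - al *: P)^T = 1%:M - al *: P.
  by rewrite raddfB /= linearZ /= PT trmx1.
have OE x y : (1%:M - al *: P) x y = (x == y)%:R - al * (u x 0 * u y 0).
  rewrite [LHS]mxE [X in X + _]mxE [X in _ + X]mxE [X in _ - X]mxE [P x y]mxE.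
  by rewrite big_ord1 [u^T _ _]mxE.
exists (1%:M - al *: P); split.
- rewrite /orthogonal_mx OT mulmxBl mul1mx mulmxBr mulmx1.
  rewrite -scalemxAl -scalemxAr PP !scalerA.
  by apply/matrixP => x y; rewrite !mxE /al; field.
- rewrite OE ui eqxx /al.
  have -> : 1%:R - 2%:R / 5%:R * (1 * 1) = 3%:R / 5%:R :> R by field.
  by rewrite mulf_neq0 ?invr_eq0 ?pnatr_eq0.
- rewrite OE ui uj [j == i]eq_sym (negPf ij) /al.
  have -> : 0%:R - 2%:R / 5%:R * (- 2%:R * 1) = 4%:R / 5%:R :> R by field.
  by rewrite mulf_neq0 ?invr_eq0 ?pnatr_eq0.
Qed.

(** The first three terms commute with conjugation by [Q], so covariance at [delta_mx i i] only
    constrains the diagonal term. At the off-diagonal entry [(j, i)] it reads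
    [0 = e * (Q j i * Q i i)]. *)
Lemma isotropic_of_orthogonal_covariant (F : fieldType) (d : nat)
    (T : 'M[F]_d -> 'M[F]_d) (Q : 'M[F]_d) (i j : 'I_d) (a b c e : F) :
  i != j -> Q *m Q^T = 1%:M -> Q i i != 0 -> Q j i != 0 ->
  (forall X, T X = a *: X + b *: X^T + c *: (\tr X)%:M + e *: diag_part X) ->
  T (Q *m delta_mx i i *m Q^T) = Q *m T (delta_mx i i) *m Q^T ->
  forall X, T X = a *: X + b *: X^T + c *: (\tr X)%:M.
Proof.
move=> ij QQ Qii Qji formT + X; rewrite [T X]formT.
suff e0 : T (Q *m delta_mx i i *m Q^T) = Q *m T (delta_mx i i) *m Q^T -> e = 0.
  by move/e0 => ->; rewrite scale0r addr0.
have QQ' : Q^T *m Q = 1%:M by apply: mulmx1C.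
rewrite !formT !mulmxDr !mulmxDl -!scalemxAr -!scalemxAl.
rewrite !trmx_mul trmxK -!mulmxA.
have -> : \tr (Q *m (delta_mx i i *m Q^T)) = \tr (delta_mx i i : 'M[F]_d).
  by rewrite mxtrace_mulC -mulmxA QQ' mulmx1.
have -> : Q *m ((\tr (delta_mx i i : 'M[F]_d))%:M *m Q^T) = (\tr (delta_mx i i : 'M[F]_d))%:M.
  by rewrite mul_scalar_mx -scalemxAr QQ scalemx1.
move/addrI/matrixP/(_ j i).
have -> : diag_part (delta_mx i i) = (delta_mx i 0 : 'cV_d) *m delta_mx 0 i :> 'M[F]_d.
  rewrite mul_delta_mx; apply/matrixP => k l; rewrite !mxE andbb.
  case: (eqVneq k l) => [->|kl]; rewrite ?andbb // mulr0n.
  by case: (eqVneq k i) kl => //= -> /negPf; rewrite eq_sym => ->.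
rewrite -mulmxA [Q *m (_ *m (_ *m _))]mulmxA -colE -rowE mxE [diag_part _ _ _]mxE.
rewrite [j == i]eq_sym (negPf ij) mulr0n mulr0.
rewrite [RHS]mxE [X in _ * X]mxE big_ord1 !mxE => /esym/eqP.
by rewrite !mulf_eq0 (negPf Qii) (negPf Qji) !orbF => /eqP.
Qed.

Lemma O_covariant_form (R : rcfType) (d : nat) (T : 'M[R[i]]_d -> 'M[R[i]]_d) (i j : 'I_d) :
  i != j -> linear T -> O_covariant T ->
  exists a b c : R[i], forall X, T X = a *: X + b *: X^T + c *: (\tr X)%:M.
Proof.
move=> ij linT covT.
have [|a [b [c [e formT]]]] := signed_perm_covariant_form ij linT.
  move=> e s X; pose f (k : 'I_d) : R := (-1) ^+ e k.
  have ortho : orthogonal_mx (monomial_mx f s).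
    by rewrite /orthogonal_mx monomial_mx_unit // => k; rewrite /f -signr_addb addbb.
  have cplxE : cplx_mx (monomial_mx f s) = monomial_mx (fun k => (-1) ^+ e k) s.
    by apply/matrixP => k l; rewrite !mxE rmorphMn /= rmorph_sign.
  by have := covT _ X ortho; rewrite cplxE !monomial_mx_conj.
have [O [orthO Oii Oji]] := exists_orthogonal_mixing R ij.
exists a, b, c; apply: (isotropic_of_orthogonal_covariant ij _ _ _ formT (covT O _ orthO)).
- have := congr1 (map_mx (real_complex R)) orthO.
  by rewrite map_mxM map_mx1 matrix.map_trmx.
- by rewrite mxE fmorph_eq0.
- by rewrite mxE fmorph_eq0.
Qed.

(** * Constraints from complete positivity and trace preservation *)

(** The expression is the quadratic form of the Choi matrix at [V]: the identity contributes the
    squared modulus of the trace, transposition the swap form, and the trace term the squared norm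
    of [V]. *)
Lemma isotropic_choi_ge0 (C : numClosedFieldType) (d : nat) (T : 'M[C]_d -> 'M[C]_d)
    (a b c : C) :
  completely_positive T ->
  (forall X, T X = a *: X + b *: X^T + c *: (\tr X)%:M) ->
  forall V : 'M[C]_d,
    0 <= a * ((\tr V)^* * \tr V)
         + \sum_p \sum_q (V p q)^* * (b * V q p + c * V p q).
Proof.
move=> cpT formT V.
have formE (x y : 'cV[C]_d) (M : 'M[C]_d) :
    (adjmx x *m M *m y) 0 0 = \sum_k \sum_l (x k 0)^* * M k l * y l 0.
  rewrite mxE exchange_big; apply: eq_bigr => l _.
  by rewrite mxE mulr_suml; apply: eq_bigr => k _; rewrite mxE.
have formD p q (x y : 'cV[C]_d) :
    (adjmx x *m delta_mx p q *m y) 0 0 = (x p 0)^* * y q 0.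
  rewrite formE (bigD1 p) //= [X in _ + X]big1 ?addr0 => [|k /negPf kp].
    rewrite (bigD1 q) //= big1 ?addr0 => [|l /negPf lq]; rewrite mxE ?eqxx ?mulr1 //.
    by rewrite lq andbF mulr0 mul0r.
  by rewrite big1 // => l _; rewrite mxE kp mulr0 mul0r.
(* Apply [T] to the maximally entangled projector, test the result on the rows of [V]. *)
have omega : block_psd (fun p q : 'I_d => delta_mx p q : 'M[C]_d).
  (* The form collapses to the squared modulus of the sum of the entries [v p p 0]. *)
  move=> v; under eq_bigr => p _ do
    (under eq_bigr => q _ do rewrite formD; rewrite -mulr_sumr).
  by rewrite -mulr_suml -rmorph_sum mulrC mul_conjC_ge0.
have := cpT _ _ omega (fun p => (row p V)^T).
congr (0 <= _).
transitivity (\sum_p \sum_q (a * ((V p p)^* * V q q)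
   + (b * ((V p q)^* * V q p) + c * (\sum_k (V p k)^* * V q k) *+ (p == q)))).
  apply: eq_bigr => p _; apply: eq_bigr => q _.
  rewrite formT trmx_delta mxtrace_delta !mulmxDr !mulmxDl -!scalemxAr -!scalemxAl.
  rewrite mul_mx_scalar -scalemxAl [LHS]mxE [X in X + _ = _]mxE.
  rewrite [X in X + _ + _ = _]mxE [X in _ + X + _ = _]mxE [X in _ + _ + X = _]mxE.
  rewrite [X in c * X]mxE !formD !mxE -addrA; congr (_ + (_ + _)).
  rewrite -[RHS]mulr_natl [RHS]mulrCA; congr (_ * (_ * _)).
  by apply: eq_bigr => k _; rewrite !mxE.
under eq_bigr => p _ do rewrite big_split /=.
rewrite big_split /=; congr (_ + _).
  rewrite rmorph_sum mulr_suml mulr_sumr; apply: eq_bigr => p _.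
  by rewrite -mulr_sumr -mulr_sumr.
apply: eq_bigr => p _; rewrite big_split /= [X in _ + X](bigD1 p) //= eqxx mulr1n.
rewrite [X in _ + (_ + X)]big1 ?addr0 => [|q /negPf qp]; last by rewrite eq_sym qp mulr0n.
by rewrite mulr_sumr -big_split; apply: eq_bigr => q _ /=; ring.
Qed.

(** The three nonnegative quantities are the Choi eigenvalues on antisymmetric matrices, on
    traceless symmetric ones, and on the identity. *)
Lemma isotropic_channel_coefs (C : numClosedFieldType) (d : nat)
    (T : 'M[C]_d -> 'M[C]_d) (a b c : C) (i j : 'I_d) :
  i != j -> quantum_channel T ->
  (forall X, T X = a *: X + b *: X^T + c *: (\tr X)%:M) ->
  [/\ 0 <= c - b, 0 <= c + b, 0 <= a * d%:R + b + c & a + b + c * d%:R = 1].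
Proof.
move=> ij [_ [cpT tpT]] formT; have choi := isotropic_choi_ge0 cpT formT.
have sgn_ge0 (s : bool) : 0 <= c + (-1) ^+ s * b.
  pose V : 'M[C]_d := delta_mx i j + (-1) ^+ s *: delta_mx j i.
  have VT p q : V q p = (-1) ^+ s * V p q.
    rewrite !mxE mulrDr mulrA -signr_addb addbb mul1r [RHS]addrC.
    by rewrite [(q == i) && _]andbC [(q == j) && _]andbC.
  have trV : \tr V = 0.
    by rewrite mxtraceD mxtraceZ !mxtrace_delta [j == i]eq_sym (negPf ij) mulr0 addr0.
  have := choi V; rewrite trV mulr0 mulr0 add0r.
  have -> : \sum_p \sum_q (V p q)^* * (b * V q p + c * V p q) =
      (c + (-1) ^+ s * b) * \sum_p \sum_q (V p q)^* * V p q.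
    rewrite mulr_sumr; apply: eq_bigr => p _; rewrite mulr_sumr.
    by apply: eq_bigr => q _; rewrite (VT p q); ring.
  have V_ge0 p q : 0 <= (V p q)^* * V p q by rewrite mulrC mul_conjC_ge0.
  (* The squared norm of [V] is positive because its entry at [(i, j)] is 1. *)
  rewrite pmulr_lge0 // (bigD1 i) //= (bigD1 j) //= -addrA ltr_pwDl //.
    by rewrite !mxE !eqxx (negPf ij) /= mulr0 addr0 rmorph1 mulr1.
  by rewrite addr_ge0 // ?sumr_ge0 // => p _; rewrite sumr_ge0.
split.
- by have := sgn_ge0 true; rewrite expr1 mulN1r.
- by have := sgn_ge0 false; rewrite expr0 mul1r.
- have d_gt0 : (0 < d)%N by apply: leq_ltn_trans (ltn_ord i).
  have := choi 1%:M; rewrite mxtrace1 rmorph_nat.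
  have -> : \sum_(p < d) \sum_(q < d) ((1%:M : 'M[C]_d) p q)^*
      * (b * (1%:M : 'M[C]_d) q p + c * (1%:M : 'M[C]_d) p q) = (b + c) * d%:R.
    rewrite mulr_natr -[d in RHS]card_ord -sumr_const; apply: eq_bigr => p _.
    rewrite (bigD1 p) //= big1 ?addr0 => [|q qp]; rewrite !mxE rmorph_nat.
      by rewrite eqxx mul1r !mulr1.
    by rewrite eq_sym (negPf qp) mul0r.
  by rewrite mulrA -mulrDl pmulr_lge0 ?ltr0n // addrA.
- have := tpT (delta_mx i i); rewrite formT !mxtraceD !mxtraceZ mxtrace_tr.
  by rewrite mxtrace_scalar mxtrace_delta eqxx !mulr1.
Qed.

(** * Assembling the mixture *)

Lemma isotropic_channel_mixture (C : numClosedFieldType) (d : nat)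
    (T : 'M[C]_d -> 'M[C]_d) (a b c : C) :
  (1 < d)%N -> ~~ odd d -> quantum_channel T ->
  (forall X, T X = a *: X + b *: X^T + c *: (\tr X)%:M) -> weighted_mixture 1 T.
Proof.
move=> d_gt1 d_even chT formT; have d_gt0 := ltnW d_gt1.
have ij : Ordinal d_gt0 != Ordinal d_gt1 by [].
have [anti_ge0 sym_ge0 id_ge0 tr1] := isotropic_channel_coefs ij chT formT.
have dn0 : d%:R != 0 :> C by rewrite pnatr_eq0 -lt0n.
(* Matching coefficients: [be - al = b] for the transpose and [al + be = c] for the trace. Then
   [ga = 2 be / d] cancels the diagonal part, and [a + ga] on the identity channel compensates the
   [- ga X] this brings in. *)
pose al := (c - b) / 2%:R; pose be := (c + b) / 2%:R; pose ga := (c + b) / d%:R.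
have al_ge0 : 0 <= al by rewrite divr_ge0.
have be_ge0 : 0 <= be by rewrite divr_ge0.
have ga_ge0 : 0 <= ga by rewrite divr_ge0.
have aga_ge0 : 0 <= a + ga.
  have -> : a + ga = (a * d%:R + b + c) / d%:R by rewrite /ga; field.
  by rewrite divr_ge0.
have U1 : unitary_mx (1%:M : 'M[C]_d).
  rewrite /unitary_mx mul1mx; apply/matrixP => k l.
  by rewrite !mxE rmorph_nat eq_sym.
have H := weighted_mixtureD (weighted_mixtureZ aga_ge0 (weighted_mixture_unitary U1))
  (weighted_mixtureD (weighted_mixtureZ al_ge0 (weighted_mixture_matching C d_even true))
  (weighted_mixtureD (weighted_mixtureZ be_ge0 (weighted_mixture_matching C d_even false))
                     (weighted_mixtureZ ga_ge0 (weighted_mixture_diag C d_gt0 d_even)))).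
apply: (eq_weighted_mixture _ _ H).
  (* The weights add up to [a + b + c d], which trace preservation sets to 1. *)
  rewrite -subn1 natrB // -[RHS]tr1 /al /be /ga; by field.
(* After the rewrite the goal is unitarity of the identity, that is [U1]. *)
have U1E : adjmx (1%:M : 'M[C]_d) = 1%:M by rewrite -[LHS]mul1mx.
move=> X; rewrite U1E mul1mx mulmx1 formT; apply/matrixP => k l; rewrite !mxE.
rewrite expr1 expr0 /al /be /ga; case: eqVneq => [->|_]; rewrite ?mulr1n ?mulr0n; by field.
Qed.

Lemma mixture_of_unitaries_weighted (R : rcfType) (d : nat) (T : 'M[R[i]]_d -> 'M[R[i]]_d) :
  weighted_mixture 1 T -> mixture_of_unitaries T.
Proof.
move=> [s [sP s1 sT]]; pose x (l : 'I_(size s)) := tnth (in_tuple s) l.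
have xP l : 0 <= (x l).1 /\ unitary_mx (x l).2 by apply: sP; exact: mem_tnth.
(* In [R[i]] a nonnegative element is real, so taking the real part loses nothing. *)
have xE l : ((complex.Re (x l).1)%:C)%C = (x l).1.
  by apply: RRe_real; apply: ger0_real; case: (xP l).
exists (size s), (fun l => complex.Re (x l).1), (fun l => (x l).2); split.
- by move=> l; rewrite -lecR xE; case: (xP l).
- apply: complexI; rewrite rmorph_sum rmorph1 -[RHS]s1 [RHS]big_tnth.
  by apply: eq_bigr => l _; exact: xE.
- by move=> l; case: (xP l).
- by move=> rho; rewrite sT big_tnth; apply: eq_bigr => l _; rewrite xE.
Qed.

Theorem theorem4 (R : realType) (d : nat) (T : 'M[R[i]]_d -> 'M[R[i]]_d) :
  ~~ odd d -> quantum_channel T -> O_covariant T -> mixture_of_unitaries T.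
Proof.
move=> d_even chT covT; apply: mixture_of_unitaries_weighted.
(* Dimension 1 is excluded by parity. In dimension 0 the matrix space is a single point, so [T] is
   conjugation by the identity. *)
case: d T d_even chT covT => [|[|d]] // T d_even chT covT.
  have U1 : unitary_mx (1%:M : 'M[R[i]]_0) by rewrite /unitary_mx [LHS]flatmx0 [RHS]flatmx0.
  apply: eq_weighted_mixture (weighted_mixture_unitary U1) => // rho.
  by rewrite [LHS]flatmx0 [RHS]flatmx0.
have ij : (ord0 : 'I_d.+2) != ord_max by [].
have [linT _] := chT.
have [a [b [c formT]]] := O_covariant_form ij linT covT.
exact: isotropic_channel_mixture formT.
Qed.
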